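(* Let $k$ be an algebraically closed field, $R=k[[X_1,\dots,X_n]]$, $K$ its quotient field, and $0<m\le n$. Let $v$ be a discrete valuation of $K/k$ of rank $m$, with values in $\mathbf Z^m$ ordered lexicographically, centered in $R$ at the maximal ideal $(X_1,\dots,X_n)$. Let $B_i=v(X_i)$ for $i=1,\dots,n$, and assume that $L=\{B_1,\dots,B_n\}\subset\mathbf Z_{\ge0}^m\setminus\{\mathbf 0\}$ is a system of generators of $\mathbf Z^m$. Then the following conditions are equivalent: 1. $v$ is the monomial valuation associated to $L$. 2. The residue field $\Delta_v$ of $v$ is the extension of $k$ (purely transcendental if $n>m$) generated by the (residues of the) $n-m$ monomials $\mathbf X^{A_1},\dots,\mathbf X^{A_{n-m}}$ (with possibly negative exponents) whose exponents $A_1,\dots,A_{n-m}\in\mathbf Z^n$ constitute a basis, as an abelian group, of the group of solutions $(y_1,\dots,y_n)\in\mathbf Z^n$ of the system $\sum_{i=1}^n y_iB_i=\mathbf 0$.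
   Context: For $A=(a_1,\dots,a_n)\in\mathbf Z^n$, $\mathbf X^A=X_1^{a_1}\cdots X_n^{a_n}$. Valuations are trivial on $k$; being centered at the maximal ideal of $R$ means that the valuation ring contains $R$ and its maximal ideal meets $R$ in $(X_1,\dots,X_n)$. Given a system of generators $L=\{B_1,\dots,B_n\}\subset\mathbf Z_{\ge0}^m\setminus\{\mathbf 0\}$ of $\mathbf Z^m$ (the $B_i$ are indexed by the variables), the $L$-degree of $\mathbf X^A$ is $\sum_{i=1}^n a_iB_i$. The monomial valuation associated to $L$ is the extension to $K$ of the function $R\to\mathbf Z^m\cup\{\infty\}$ sending $0$ to $\infty$ and $0\ne f=\sum_A f_A\mathbf X^A$ to $\min_{\mathrm{lex}}\{\sum_i a_iB_i\mid f_A\ne 0\}$; its value group is $\mathbf Z^m$. *)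

(* Defs.v *)
From HB Require Import structures.
From mathcomp Require Import all_boot all_order all_algebra.
From mathcomp Require Import ring_quotient generic_quotient.
From mathcomp Require Import boolp mpoly.

Set Implicit Arguments.
Unset Strict Implicit.
Unset Printing Implicit Defensive.

Import Order.TTheory GRing.Theory Num.Theory.
Local Open Scope ring_scope.
Local Open Scope quotient_scope.

Record pseries (n : nat) (k : Type) := PSeries { pcoef : 'X_{1..n} -> k }.

HB.instance Definition _ n k := gen_eqMixin (pseries n k).
HB.instance Definition _ n k := gen_choiceMixin (pseries n k).

Section PSeriesRing.
Variables (n : nat) (k : comNzRingType).
Implicit Types (f g h : pseries n k) (A : 'X_{1..n}).

Lemma pseriesP f g : (forall A, pcoef f A = pcoef g A) -> f = g.
Proof. by case: f g => f [g] /= /funext ->. Qed.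

Definition ps_zero : pseries n k := PSeries (fun=> 0).
Definition ps_opp f := PSeries (fun A => - pcoef f A).
Definition ps_add f g := PSeries (fun A => pcoef f A + pcoef g A).

Fact ps_addA : associative ps_add.
Proof. by move=> f g h; apply: pseriesP => A /=; rewrite addrA. Qed.
Fact ps_addC : commutative ps_add.
Proof. by move=> f g; apply: pseriesP => A /=; rewrite addrC. Qed.
Fact ps_add0 : left_id ps_zero ps_add.
Proof. by move=> f; apply: pseriesP => A /=; rewrite add0r. Qed.
Fact ps_addN : left_inverse ps_zero ps_opp ps_add.
Proof. by move=> f; apply: pseriesP => A /=; rewrite addNr. Qed.

HB.instance Definition _ :=
  GRing.isZmodule.Build (pseries n k) ps_addA ps_addC ps_add0 ps_addN.

Definition pseriesC (c : k) : pseries n k :=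
  PSeries (fun A => if A == 0%MM then c else 0).

Definition pseriesX (i : 'I_n) : pseries n k :=
  PSeries (fun A => (A == U_(i)%MM)%:R).

(* The sum ranges over all decompositions A = A1 + A2; the degree bounds only
   make the index type finite. *)
Definition ps_mul f g : pseries n k :=
  PSeries (fun A =>
    \sum_(AA : 'X_{1..n < (mdeg A).+1, (mdeg A).+1} | A == (AA.1 + AA.2)%MM)
      pcoef f AA.1 * pcoef g AA.2).

Definition ps_trunc d f : {mpoly k[n]} :=
  \sum_(A : 'X_{1..n < d}) pcoef f A *: 'X_[A].

Lemma mcoeff_trunc d f A : (mdeg A < d)%N -> (ps_trunc d f)@_A = pcoef f A.
Proof. by move=> ltAd; rewrite mcoeff_mpoly. Qed.

Lemma pcoef_mul d f g A : (mdeg A < d)%N ->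
  pcoef (ps_mul f g) A = (ps_trunc d f * ps_trunc d g)@_A.
Proof.
move=> ltAd; rewrite mcoeffM /=; apply: eq_bigr => -[A1 A2] /= _.
rewrite !mcoeff_trunc //; apply: leq_ltn_trans ltAd; rewrite -ltnS;
  exact: bmdeg.
Qed.

Lemma mcoeffM_congr (p p' q q' : {mpoly k[n]}) A :
    (forall B, (mdeg B <= mdeg A)%N -> p@_B = p'@_B) ->
    (forall B, (mdeg B <= mdeg A)%N -> q@_B = q'@_B) ->
  (p * q)@_A = (p' * q')@_A.
Proof.
move=> eqp eqq; rewrite !mcoeffM; apply: eq_bigr => -[A1 A2] /= _.
by rewrite eqp ?eqq // -ltnS bmdeg.
Qed.

Fact ps_mulA : associative ps_mul.
Proof.
move=> f g h; apply: pseriesP => A; set d := (mdeg A).+1.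
rewrite !(@pcoef_mul d) //.
transitivity ((ps_trunc d f * (ps_trunc d g * ps_trunc d h))@_A).
  apply: mcoeffM_congr => // B leBA.
  by rewrite mcoeff_trunc // (@pcoef_mul d).
rewrite mulrA; apply: mcoeffM_congr => // B leBA.
by rewrite mcoeff_trunc // (@pcoef_mul d).
Qed.

Fact ps_mulC : commutative ps_mul.
Proof.
move=> f g; apply: pseriesP => A; rewrite !(@pcoef_mul (mdeg A).+1) //.
by rewrite mulrC.
Qed.

Fact ps_mul1 : left_id (pseriesC 1) ps_mul.
Proof.
move=> f; apply: pseriesP => A; rewrite (@pcoef_mul (mdeg A).+1) //.
transitivity ((1 * ps_trunc (mdeg A).+1 f)@_A); last first.
  by rewrite mul1r mcoeff_trunc.
apply: mcoeffM_congr => // B leBA; rewrite mcoeff_trunc // mcoeff1 /=.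
by case: (B == 0%MM).
Qed.

Fact ps_mulDl : left_distributive ps_mul ps_add.
Proof.
move=> f g h; apply: pseriesP => A /=; rewrite -big_split /=.
by apply: eq_bigr => AA _; rewrite mulrDl.
Qed.

Fact ps_one_neq0 : pseriesC 1 != 0.
Proof.
apply/eqP => /(congr1 (fun f => pcoef f 0%MM)) /= /eqP.
by rewrite eqxx oner_eq0.
Qed.

HB.instance Definition _ := GRing.Zmodule_isComNzRing.Build (pseries n k)
  ps_mulA ps_mulC ps_mul1 ps_mulDl ps_one_neq0.

Definition ps_unit : {pred pseries n k} :=
  [pred f | `[< exists g, g * f = 1 >]].

Definition ps_inv f : pseries n k :=
  if pselect (exists g, g * f = 1) is left fV then projT1 (cid fV) else f.

Fact ps_mulV : {in ps_unit, left_inverse 1 ps_inv *%R}.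
Proof.
move=> f /asboolP fV; rewrite /ps_inv; case: pselect => // fV'.
exact: (projT2 (cid fV')).
Qed.
Fact ps_unitP f g : g * f = 1 -> ps_unit f.
Proof. by move=> gf1; apply/asboolP; exists g. Qed.
Fact ps_inv_out : {in [predC ps_unit], ps_inv =1 id}.
Proof.
by move=> f /asboolP fNV; rewrite /ps_inv; case: pselect.
Qed.

HB.instance Definition _ := GRing.ComNzRing_hasMulInverse.Build (pseries n k)
  ps_mulV ps_unitP ps_inv_out.

End PSeriesRing.

Section PSeriesDomain.
Variables (n : nat) (k : idomainType).

Lemma ps_min_supp (f : pseries n k) : f != 0 ->
  exists2 A, pcoef f A != 0 & forall B, (B < A)%O -> pcoef f B = 0.
Proof.
move=> f0; have [A fA] : exists A, pcoef f A != 0.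
  apply: contrapT => fN; case/eqP: f0; apply: pseriesP => A.
  by apply: contrapT => /eqP fA; case: fN; exists A.
elim/(@ltmwf n): A fA => A IH fA.
have [minA | /existsNP[B /not_implyP[ltBA /eqP fB]]] :=
  pselect (forall B, (B < A)%O -> pcoef f B = 0); first by exists A.
exact: (IH B).
Qed.

Fact ps_idomain : GRing.integral_domain_axiom (pseries n k).
Proof.
move=> f g fg0; apply: contrapT => /negP; rewrite negb_or => /andP[f0 g0].
have [A fA minA] := ps_min_supp f0; have [B gB minB] := ps_min_supp g0.
have : pcoef (f * g) (A + B)%MM = 0 by rewrite fg0.
have ltA : (mdeg A < (mdeg (A + B)).+1)%N by rewrite mdegD ltnS leq_addr.
have ltB : (mdeg B < (mdeg (A + B)).+1)%N by rewrite mdegD ltnS leq_addl.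
rewrite /= (bigD1 (BMultinom ltA, BMultinom ltB)) //= big1 ?addr0 => [|AB].
  by move/eqP; rewrite mulf_eq0 (negPf fA) (negPf gB).
case: AB => -[A' ltA'] [B' ltB'] /= /andP[/eqP eqAB neq].
have [/minA -> | leA] := ltP A' A; first by rewrite mul0r.
have [/minB -> | leB] := ltP B' B; first by rewrite mulr0.
have eqA : A' = A.
  apply/le_anti; rewrite leA andbT leNgt; apply/negP => ltAA.
  by have := ltmc_le_add ltAA leB; rewrite -eqAB ltxx.
have eqB : B' = B.
  by move: eqAB; rewrite eqA => /addmI ->.
by case/eqP: neq; congr pair; apply: val_inj.
Qed.

HB.instance Definition _ :=
  GRing.ComUnitRing_isIntegral.Build (pseries n k) ps_idomain.

End PSeriesDomain.

Definition psfrac n (k : fieldType) : fieldType := {fraction (pseries n k)}.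

Definition psemb n (k : fieldType) (f : pseries n k) : psfrac n k := tofrac f.

Definition psfracC n (k : fieldType) (c : k) : psfrac n k :=
  psemb (pseriesC n c).

Definition psmon n (k : fieldType) (A : 'rV[int]_n) : psfrac n k :=
  \prod_(i < n) psemb (pseriesX k i) ^ A 0 i.

Definition in_maxideal n (k : fieldType) (f : pseries n k) : Prop :=
  exists g : 'I_n -> pseries n k, f = \sum_(i < n) g i * pseriesX k i.

Definition lexle m (a b : 'rV[int]_m) : bool :=
  (([tuple a 0 i | i < m] : m.-tuplelexi int)
     <= ([tuple b 0 i | i < m] : m.-tuplelexi int))%O.

(* None stands for the value oo. *)
Definition exval m := option 'rV[int]_m.

Section ExtendedValues.
Variable m : nat.
Implicit Types a b : exval m.

Definition vadd a b : exval m :=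
  match a, b with Some x, Some y => Some (x + y) | _, _ => None end.

Definition vle a b : bool :=
  match a, b with
  | _, None => true
  | None, Some _ => false
  | Some x, Some y => lexle x y
  end.

Definition vlt a b : bool := ~~ vle b a.

Definition vmin a b : exval m := if vle a b then a else b.

End ExtendedValues.

Record valuation (K : fieldType) (m : nat) := Valuation {
  val_of :> K -> exval m;
  val_infty : forall x, val_of x = None <-> x = 0;
  val_mul : forall x y, val_of (x * y) = vadd (val_of x) (val_of y);
  val_add : forall x y, vle (vmin (val_of x) (val_of y)) (val_of (x + y)) }.

(* The value group is isomorphic to Z^r with the lexicographic order, as an
   ordered group. *)
Definition discrete_of_rank (K : fieldType) m (v : valuation K m) (r : nat) :=
  exists phi : {additive 'rV[int]_r -> 'rV[int]_m},
    (forall a b, lexle (phi a) (phi b) = lexle a b)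
    /\ (forall b, (exists x, v x = Some b) <-> (exists a, b = phi a)).

Definition trivial_on (k K : fieldType) (iota : k -> K) m (v : valuation K m) :=
  forall c, c != 0 -> v (iota c) = Some 0.

Lemma lexle_refl m (a : 'rV[int]_m) : lexle a a.
Proof. exact: lexx. Qed.

Lemma lexle_trans m (b a c : 'rV[int]_m) : lexle a b -> lexle b c -> lexle a c.
Proof. exact: le_trans. Qed.

Lemma lexle_total m (a b : 'rV[int]_m) : lexle a b || lexle b a.
Proof. exact: le_total. Qed.

Lemma lexle_anti m (a b : 'rV[int]_m) : lexle a b -> lexle b a -> a = b.
Proof.
move=> ab ba; have /(_ _) eqab := @le_anti _ (m.-tuplelexi int).
have /eqab {eqab} E : lexle a b && lexle b a by rewrite ab ba.
apply/rowP => i.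
by have /(congr1 (fun t : m.-tuple int => tnth t i)) := E; rewrite !tnth_mktuple.
Qed.

Lemma lexleD2r m (c a b : 'rV[int]_m) : lexle (a + c) (b + c) = lexle a b.
Proof.
have D (x y z : 'rV[int]_m) : lexle x y -> lexle (x + z) (y + z).
  move=> /lexi_tupleP[j lexj]; apply/lexi_tupleP; exists j => i leij.
  have := lexj i leij; rewrite !tnth_mktuple !mxE /Order.leif lerD2r.
  by rewrite (inj_eq (addIr _)).
apply/idP/idP => [/(D _ _ (- c))|]; last exact: D.
by rewrite !addrK.
Qed.

Section ValuationTheory.
Variables (K : fieldType) (m : nat) (v : valuation K m).
Implicit Types x y : K.

Lemma val_neq0 x : x != 0 -> exists a, v x = Some a.
Proof.
move=> x0; case E: (v x) => [a|]; first by exists a.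
by move/val_infty: E x0 => ->; rewrite eqxx.
Qed.

Lemma val1 : v 1 = Some 0.
Proof.
have [a Ea] := val_neq0 (oner_neq0 K).
have := val_mul v 1 1; rewrite mulr1 Ea /= => -[/eqP].
by rewrite -subr_eq0 opprD addNKr oppr_eq0 => /eqP ->.
Qed.

Lemma val0 : v 0 = None. Proof. exact/val_infty. Qed.

Lemma valN x : v (- x) = v x.
Proof.
have [a Ea] : exists a, v (-1) = Some a.
  by apply: val_neq0; rewrite oppr_eq0 oner_neq0.
have : v (-1 * -1) = Some (a + a) by rewrite val_mul Ea.
rewrite mulrNN mulr1 val1 => -[/esym/rowP a2].
have a0 : a = 0.
  apply/rowP => i; have := a2 i; rewrite !mxE => /eqP.
  by rewrite -mulr2n mulrn_eq0 /= => /eqP.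
by rewrite -mulN1r val_mul Ea a0; case: (v x) => [b|] //=; rewrite add0r.
Qed.

Lemma vle_trans (b a c : exval m) : vle a b -> vle b c -> vle a c.
Proof. by case: a b c => [a|] [b|] [c|] //=; apply: lexle_trans. Qed.

Lemma vle_total (a b : exval m) : vle a b || vle b a.
Proof. by case: a b => [a|] [b|] //=; apply: lexle_total. Qed.

Lemma vlt_le_trans (b a c : exval m) : vlt a b -> vle b c -> vlt a c.
Proof. by rewrite /vlt => ab bc; apply: contra ab; apply: vle_trans bc. Qed.

Lemma vlt_min (a b c : exval m) : vlt c a -> vlt c b -> vlt c (vmin a b).
Proof. by move=> ca cb; rewrite /vmin; case: ifP. Qed.

Lemma vle_min (a b c : exval m) : vle c a -> vle c b -> vle c (vmin a b).
Proof. by move=> ca cb; rewrite /vmin; case: ifP. Qed.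

Definition valring : {pred K} := [pred x | vle (Some 0) (v x)].

Fact valring_subring : subring_closed valring.
Proof.
split=> [|x y|x y]; rewrite !inE.
- by rewrite val1 /=; apply: lexle_refl.
- by move=> vx vy; apply: vle_trans (val_add v _ _); rewrite vle_min ?valN.
rewrite val_mul; case: (v x) (v y) => [a|] [b|] //= a0 b0.
by apply: lexle_trans b0 _; rewrite -{1}[b]add0r lexleD2r.
Qed.

HB.instance Definition _ := GRing.isSubringClosed.Build K valring
  valring_subring.

Record valring_type :=
  ValRing { valring_val :> K; _ : valring_val \in valring }.
HB.instance Definition _ := [isSub for valring_val].
HB.instance Definition _ := [Choice of valring_type by <:].
HB.instance Definition _ := [SubChoice_isSubComNzRing of valring_type by <:].

Definition valideal : {pred valring_type} :=
  [pred x | vlt (Some 0) (v (val x))].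

Fact valideal_idealr : idealr_closed valideal.
Proof.
split=> [||a x y]; rewrite !inE.
- by rewrite rmorph0 val0.
- by rewrite rmorph1 val1 /vlt negbK; apply: lexle_refl.
rewrite rmorphD rmorphM /= => vx vy.
apply: vlt_le_trans (val_add v _ _); apply: vlt_min => //.
apply: vlt_le_trans vx _; rewrite val_mul.
have := valP a; rewrite inE /=.
case: (v (valring_val a)) => [b|] /=; last by case: (v _).
by case: (v _) => [c|] //= b0; rewrite -{1}[c]add0r lexleD2r.
Qed.

HB.instance Definition _ :=
  isIdealr.Build valring_type valideal valideal_idealr.

Definition residue_field := {ideal_quot valideal}.

HB.instance Definition _ := GRing.ComNzRing.on residue_field.

(* Total on K: the class modulo the maximal ideal for x in the valuation ring,
   and the junk value 0 elsewhere. *)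
Definition residue (x : K) : residue_field :=
  \pi_residue_field (insubd (0 : valring_type) x).

Lemma residue_repr (z : residue_field) : residue (val (repr z)) = z.
Proof. by rewrite /residue valKd reprK. Qed.

Lemma residue_eq0 x : x \in valring -> (residue x == 0) = vlt (Some 0) (v x).
Proof.
move=> vx; rewrite -[0](rmorph0 (\pi_residue_field)) /residue.
by rewrite -Quotient.idealrBE subr0 inE insubdK.
Qed.

Definition residue_inv (z : residue_field) : residue_field :=
  if z == 0 then 0 else residue (val (repr z))^-1.

Fact residue_mulV z : z != 0 -> residue_inv z * z = 1.
Proof.
move=> z0; rewrite /residue_inv (negPf z0).
set x := repr z; have vx := valP x.
have {z0} v0 : v (val x) = Some 0.
  move: z0; rewrite -(residue_repr z) residue_eq0 // /vlt negbK -/x.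
  move: vx; rewrite inE; case: (v _) => [a|] //= a0 a0'.
  by congr Some; apply: lexle_anti.
have x0 : val x != 0 by apply/eqP => x0; move: v0; rewrite x0 val0.
have vxV : (val x)^-1 \in valring.
  have := val_mul v (val x)^-1 (val x); rewrite mulVf // v0 val1 inE.
  case: (v _) => [a|] //= [E]; rewrite addr0 in E.
  by rewrite -E lexle_refl.
rewrite -[z]reprK -/x /residue -rmorphM -(rmorph1 (\pi_residue_field)).
by congr \pi; apply: val_inj; rewrite rmorphM rmorph1 /= insubdK // mulVf.
Qed.

Fact residue_inv0 : residue_inv 0 = 0.
Proof. by rewrite /residue_inv eqxx. Qed.

HB.instance Definition _ :=
  GRing.ComNzRing_isField.Build residue_field residue_mulV residue_inv0.

End ValuationTheory.

Definition generated_over (k F : fieldType) (iota : k -> F) r (t : 'I_r -> F) :=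
  forall P : {pred F}, divring_closed P ->
    (forall c, iota c \in P) -> (forall j, t j \in P) -> forall x, x \in P.

Definition alg_independent (k F : fieldType) (iota : k -> F) r (t : 'I_r -> F) :=
  forall p : {mpoly k[r]}, mmap iota t p = 0 -> p = 0.

Definition Zbasis (V : zmodType) r (A : 'I_r -> V) (S : V -> Prop) :=
  (forall y, S y <-> exists c : 'I_r -> int, y = \sum_(j < r) A j *~ c j)
  /\ (forall c : 'I_r -> int, \sum_(j < r) A j *~ c j = 0 -> forall j, c j = 0).

Definition centered n (k : fieldType) m (v : valuation (psfrac n k) m) :=
  forall f : pseries n k,
    vle (Some 0) (v (psemb f)) /\ (vlt (Some 0) (v (psemb f)) <-> in_maxideal f).

Definition Ldeg n m (B : 'I_n -> 'rV[int]_m) (A : 'rV[int]_n) : 'rV[int]_m :=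
  \sum_(i < n) B i *~ A 0 i.

Definition mnm_exponent n (A : 'X_{1..n}) : 'rV[int]_n := \row_i (A i)%:Z.

(* b is the lexicographic minimum of the L-degrees of the monomials of f,
   and b = oo for f = 0. *)
Definition is_Lorder n (k : fieldType) m (B : 'I_n -> 'rV[int]_m)
    (f : pseries n k) (b : exval m) : Prop :=
  match b with
  | None => f = 0
  | Some b =>
      (exists2 A, pcoef f A != 0 & b = Ldeg B (mnm_exponent A))
      /\ (forall A, pcoef f A != 0 -> lexle b (Ldeg B (mnm_exponent A)))
  end.

(* Multiplicativity of v makes its restriction to the power series ring
   determine it on the quotient field, so this says that v is the extension of
   the L-order. *)
Definition monomial_valuation n (k : fieldType) m (B : 'I_n -> 'rV[int]_m)
    (v : valuation (psfrac n k) m) :=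
  forall f : pseries n k, is_Lorder B f (v (psemb f)).

(* Main.v *)
(* Both conditions are equivalent to the following: for finitely many distinct
   Laurent monomials of the same L-degree b, every linear combination with a
   nonzero coefficient has value exactly b.  Dividing by one of the monomials
   turns the others into Laurent monomials in X^A_1, ..., X^A_(n-m), so this
   amounts to the algebraic independence of the residues of the X^A_j.  It
   determines v: by Dickson's lemma a power series whose monomials have degree
   greater than b lies in the ideal generated by finitely many of them, so that,
   v being nonnegative on R, its value is greater than b; hence only the part of
   minimal degree of a power series matters, and this part is finite because the
   B_i are nonzero with nonnegative entries.  Generation of the residue field
   follows by replacing numerator and denominator of a fraction of value 0 with
   their parts of minimal degree.  The basis A_1, ..., A_(n-m) exists by the
   Smith normal form of the matrix of the B_i. *)

Require Import Defs.
From HB Require Import structures.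
From mathcomp Require Import all_boot all_order all_algebra.
From mathcomp Require Import ring_quotient generic_quotient.
From mathcomp Require Import boolp mpoly.

Set Implicit Arguments.
Unset Strict Implicit.
Unset Printing Implicit Defensive.

Import Order.TTheory GRing.Theory Num.Theory.
Local Open Scope ring_scope.
Local Open Scope quotient_scope.

(** * Dickson's lemma *)

(** Induction on the list of coordinates where domination is required, for all [S] at once. If [s0]
    handles the remaining coordinates, it also dominates the elements with large [i]-th entry; the
    others lie in finitely many slices of constant [i]-th entry. *)
Lemma dickson n (S : 'X_{1..n} -> Prop) :
  exists2 s : seq 'X_{1..n}, {in s, forall B, S B}
    & forall A, S A -> exists2 B, B \in s & (B <= A)%MM.
Proof.
have [s sS domS] : exists2 s : seq 'X_{1..n}, {in s, forall B, S B}
    & forall A, S A ->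
        exists2 B, B \in s & {in enum 'I_n, forall i, B i <= A i}%N.
  elim: (enum 'I_n) S => [|i r IH] S.
    have [[A SA]|noS] := pselect (exists A, S A).
      exists [:: A] => [B|B _]; first by rewrite inE => /eqP->.
      by exists A; rewrite ?mem_head.
    by exists [::] => // A SA; case: noS; exists A.
  have [s0 s0S dom0] := IH S.
  (* Once [A i] is at least [M], an element of [s0] below [A] on [r] is below it at [i] too. *)
  pose M := \max_(B <- s0) B i.
  have slices (c : nat) : exists2 s : seq 'X_{1..n}, {in s, forall B, S B}
      & forall A, S A -> (A i < c)%N ->
          exists2 B, B \in s & {in i :: r, forall j, B j <= A j}%N.
    elim: c => [|c [s sS doms]]; first by exists [::].
    have [s1 s1S dom1] := IH (fun A => S A /\ A i = c).
    exists (s ++ s1) => [B|A SA].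
      by rewrite mem_cat => /orP[/sS //|/s1S[]].
    rewrite ltnS leq_eqVlt => /predU1P[eqc|ltc].
      have [B Bs1 leB] := dom1 A (conj SA eqc).
      exists B => [|j]; first by rewrite mem_cat Bs1 orbT.
      rewrite inE => /predU1P[->|/leB //].
      by have [_ ->] := s1S B Bs1; rewrite eqc.
    by have [B Bs leB] := doms A SA ltc; exists B; rewrite // mem_cat Bs.
  have [s1 s1S dom1] := slices M.
  exists (s0 ++ s1) => [B|A SA].
    by rewrite mem_cat => /orP[/s0S|/s1S].
  have [/(dom1 A SA)[B Bs1 leB]|leM] := ltnP (A i) M.
    by exists B; rewrite // mem_cat Bs1 orbT.
  have [B Bs0 leB] := dom0 A SA; exists B; first by rewrite mem_cat Bs0.
  move=> j; rewrite inE => /predU1P[->|/leB //].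
  by apply: leq_trans leM; rewrite /M (big_rem B Bs0) leq_maxl.
exists s => // A /domS[B Bs leB]; exists B => //.
by apply/mnm_lepP => i; apply: leB; rewrite mem_enum.
Qed.

(** * Monomials as power series *)

Section Monomials.
Variables (n : nat) (k : fieldType).
Implicit Types (A C : 'X_{1..n}) (f g : pseries n k).

Definition psX A : pseries n k := PSeries (fun C => (C == A)%:R).

Lemma pcoefD f g A : pcoef (f + g) A = pcoef f A + pcoef g A.
Proof. by []. Qed.

Lemma pcoef_sum I (r : seq I) (P : pred I) (F : I -> pseries n k) A :
  pcoef (\sum_(i <- r | P i) F i) A = \sum_(i <- r | P i) pcoef (F i) A.
Proof. by elim/big_rec2: _ => // i c f _ <-. Qed.

(** Only the decomposition of [C] with first part [A] contributes, and it exists exactly when [X^A]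
    divides [X^C]. *)
Lemma pcoefXM A g C :
  pcoef (psX A * g) C = if (A <= C)%MM then pcoef g (C - A)%MM else 0.
Proof.
rewrite /=; case: ifPn => leAC.
  have ltA : (mdeg A < (mdeg C).+1)%N.
    by rewrite ltnS !mdegE leq_sum // => i _; apply/mnm_lepP.
  have ltB : (mdeg (C - A) < (mdeg C).+1)%N by rewrite ltnS mdegB.
  rewrite (bigD1 (BMultinom ltA, BMultinom ltB)) /=; last first.
    by rewrite addmC submK.
  rewrite eqxx mul1r big1 ?addr0 // => -[[A' ltA'] [B' ltB']] /=.
  case/andP => /eqP eqC neq; case: (A' =P A) => [eqA|]; last by rewrite mul0r.
  by case/eqP: neq; congr pair; apply: val_inj; rewrite //= eqC eqA addmC addmK.
rewrite big1 // => -[[A' ltA'] [B' ltB']] /= /eqP eqC.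
case: (A' =P A) => [eqA|]; last by rewrite mul0r.
by rewrite eqC eqA lem_addr in leAC.
Qed.

Lemma psXD A C : psX (A + C) = psX A * psX C.
Proof.
apply: pseriesP => D; rewrite pcoefXM /=; case: ifPn => leAD.
  congr (nat_of_bool _)%:R; apply/eqP/eqP => [->|<-].
    by rewrite addmC addmK.
  by rewrite addmC submK.
by case: eqP => // eqD; rewrite eqD lem_addr in leAD.
Qed.

Lemma psX0 : psX 0%MM = 1.
Proof. by apply: pseriesP => A /=; case: eqP. Qed.

Lemma pcoefCM c g A : pcoef (pseriesC n c * g) A = c * pcoef g A.
Proof.
have lt0 : (mdeg (0%MM : 'X_{1..n}) < (mdeg A).+1)%N by rewrite mdeg0.
rewrite /= (bigD1 (BMultinom lt0, BMultinom (ltnSn _))) /=; last by rewrite add0m.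
rewrite eqxx big1 ?addr0 // => -[[A' ltA'] [B' ltB']] /=.
case/andP => /eqP eqA neq; case: (A' =P 0%MM) => [eq0|]; last by rewrite mul0r.
by case/eqP: neq; congr pair; apply: val_inj; rewrite //= eqA eq0 add0m.
Qed.

Lemma psXE A : psX A = \prod_(i < n) pseriesX k i ^+ A i.
Proof.
have XUn i d : psX (U_(i) *+ d)%MM = pseriesX k i ^+ d.
  by elim: d => [|d IH]; rewrite ?mulm0n ?psX0 // mulmS psXD IH exprS.
rewrite {1}(multinomUE_id A) -(eq_bigr _ (fun i _ => XUn i (A i))).
by elim/big_rec2: _ => [|i f C _ <-]; rewrite ?psX0 ?psXD.
Qed.

End Monomials.

(** * Laurent monomials in the quotient field *)

Section LaurentMonomials.
Variables (n : nat) (k : fieldType).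

HB.instance Definition _ :=
  GRing.RMorphism.copy (@psemb n k) (@tofrac (pseries n k)).

Lemma psemb_eq0 (f : pseries n k) : (psemb f == 0) = (f == 0).
Proof. exact: tofrac_eq0. Qed.

Lemma psembD : {morph @psemb n k : f g / f + g}. Proof. exact: rmorphD. Qed.
Lemma psembM : {morph @psemb n k : f g / f * g}. Proof. exact: rmorphM. Qed.
Lemma psemb0 : psemb (0 : pseries n k) = 0. Proof. exact: rmorph0. Qed.

Lemma psemb_sum I (r : seq I) (P : pred I) (F : I -> pseries n k) :
  psemb (\sum_(i <- r | P i) F i) = \sum_(i <- r | P i) psemb (F i).
Proof. exact: rmorph_sum. Qed.

Lemma psfracE (x : psfrac n k) :
  exists f, exists2 g, g != 0 & x = psemb f / psemb g.
Proof.
elim/quotW: x => x; exists (frac x).1, (frac x).2; first exact: denom_ratioP.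
apply: (canRL (mulfK _)); first by rewrite psemb_eq0 denom_ratioP.
(* Equality of classes is reduced to an identity between cross products of numerators and
   denominators. *)
rewrite /psemb; unlock tofrac; rewrite -[LHS]FracField.pi_mul; apply/eqmodP.
rewrite /= FracField.equivfE /FracField.mulf.
by rewrite !numden_Ratio ?(oner_eq0, mulf_neq0, denom_ratioP) ?mulr1 1?mulrC.
Qed.

Lemma pseriesX_neq0 i : pseriesX k i != 0 :> pseries n k.
Proof.
apply/eqP => /(congr1 (fun f => pcoef f U_(i)%MM)) /= /eqP.
by rewrite eqxx oner_eq0.
Qed.

Lemma psmonD (y z : 'rV[int]_n) : psmon k (y + z) = psmon k y * psmon k z.
Proof.
rewrite /psmon -big_split; apply: eq_bigr => i _.
by rewrite mxE expfzDr // psemb_eq0 pseriesX_neq0.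
Qed.

Lemma psmon0 : psmon k (0 : 'rV[int]_n) = 1.
Proof. by rewrite /psmon big1 // => i _; rewrite mxE. Qed.

Lemma psmon_neq0 (y : 'rV[int]_n) : psmon k y != 0.
Proof.
apply/prodf_neq0 => i _; apply: expfz_neq0.
by rewrite psemb_eq0 pseriesX_neq0.
Qed.

Lemma psmonMz (y : 'rV[int]_n) c : psmon k (y *~ c) = psmon k y ^ c.
Proof.
have psmonMn (z : 'rV[int]_n) d : psmon k (z *+ d) = psmon k z ^+ d.
  by elim: d => [|d IH]; rewrite ?psmon0 // mulrS psmonD IH exprS.
case: c => d; first exact: psmonMn.
rewrite NegzE mulrNz -invr_expz; apply: (mulIf (psmon_neq0 (y *+ d.+1))).
by rewrite -psmonD addNr psmon0 psmonMn mulVf // expf_neq0 // psmon_neq0.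
Qed.

Lemma psmon_sum I (r : seq I) (P : pred I) (F : I -> 'rV[int]_n) :
  psmon k (\sum_(i <- r | P i) F i) = \prod_(i <- r | P i) psmon k (F i).
Proof.
by elim/big_rec2: _ => [|i x y _ <-]; rewrite ?psmon0 ?psmonD.
Qed.

Lemma mnm_exponentD (A C : 'X_{1..n}) :
  mnm_exponent (A + C)%MM = mnm_exponent A + mnm_exponent C.
Proof. by apply/rowP => i; rewrite !mxE mnmDE PoszD. Qed.

Lemma mnm_exponent_inj : injective (@mnm_exponent n).
Proof.
by move=> A C /rowP eqAC; apply/mnmP => i; have := eqAC i; rewrite !mxE => -[].
Qed.

Lemma psmon_mnm (A : 'X_{1..n}) : psmon k (mnm_exponent A) = psemb (psX k A).
Proof.
rewrite psXE rmorph_prod; apply: eq_bigr => i _.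
by rewrite mxE rmorphXn.
Qed.

End LaurentMonomials.

(** * The L-degree as a linear map *)

Section Ldeg.
Variables (n m : nat) (B : 'I_n -> 'rV[int]_m).

Lemma LdegD y z : Ldeg B (y + z) = Ldeg B y + Ldeg B z.
Proof.
by rewrite /Ldeg -big_split; apply: eq_bigr => i _; rewrite mxE mulrzDr.
Qed.

Lemma LdegN y : Ldeg B (- y) = - Ldeg B y.
Proof. by rewrite /Ldeg -sumrN; apply: eq_bigr => i _; rewrite mxE mulrNz. Qed.

Lemma LdegB y z : Ldeg B (y - z) = Ldeg B y - Ldeg B z.
Proof. by rewrite LdegD LdegN. Qed.

Lemma Ldeg_mx y : Ldeg B y = y *m (\matrix_(i < n) B i).
Proof.
apply/rowP => j; rewrite /Ldeg summxE mxE; apply: eq_bigr => i _.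
by rewrite -scaler_int !mxE intz.
Qed.

End Ldeg.

(** * Values and residues of sums, products and powers *)

Section Residue.
Variables (K : fieldType) (m : nat) (v : valuation K m).
Implicit Types x y : K.

Lemma lexle_add0 (a b : 'rV[int]_m) : lexle 0 a -> lexle b (a + b).
Proof. by rewrite -[X in lexle X (_ + _)]add0r lexleD2r. Qed.

Lemma vlt_vle (a b : exval m) : vlt a b -> vle a b.
Proof.
by rewrite /vlt => nba; have := vle_total a b; rewrite (negPf nba) orbF.
Qed.

Lemma vlt_addN (b : 'rV[int]_m) (a : exval m) :
  vlt (Some 0) (vadd (Some (- b)) a) = vlt (Some b) a.
Proof.
by case: a => [a|] //; rewrite /vlt /= -(lexleD2r b) addrAC addNr !add0r.
Qed.

(** The reverse bound comes from [x = (x + y) - y], where strictness prevents the value of [y] from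
    being the minimum. *)
Lemma val_addl x y : vlt (v x) (v y) -> v (x + y) = v x.
Proof.
move=> ltxy; have := val_add v x y; rewrite /vmin (vlt_vle ltxy) => le1.
have := val_add v (x + y) (- y); rewrite addrK valN /vmin.
case: ifP => _ le2; last by rewrite /vlt le2 in ltxy.
case: (v x) (v (x + y)) le1 le2 => [a|] [b|] //= ab ba.
by rewrite (lexle_anti ab ba).
Qed.

Lemma val_neq0_of_Some x a : v x = Some a -> x != 0.
Proof. by move=> vx; apply/eqP => x0; rewrite x0 val0 in vx. Qed.

Lemma valV x a : v x = Some a -> v x^-1 = Some (- a).
Proof.
move=> vx; have x0 := val_neq0_of_Some vx.
have := val_mul v x x^-1; rewrite divff // Defs.val1 vx.
case: (v x^-1) => [b|] //= [/esym/eqP]; rewrite addr_eq0 => /eqP ->.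
by rewrite opprK.
Qed.

Lemma val_exprz x a c : v x = Some a -> v (x ^ c) = Some (a *~ c).
Proof.
move=> vx; have vxn d : v (x ^+ d) = Some (a *+ d).
  by elim: d => [|d IH]; rewrite ?Defs.val1 // exprS val_mul vx IH mulrS.
by case: c => d; [apply: vxn | rewrite NegzE -invr_expz (valV (vxn _)) mulrNz].
Qed.

Lemma val0_valring x : v x = Some 0 -> x \in valring v.
Proof. by move=> vx; rewrite inE vx /= lexle_refl. Qed.

(** Membership is required because [residue] takes the default value 0 outside the valuation
    ring. *)
Lemma residueD x y : x \in valring v -> y \in valring v ->
  residue v (x + y) = residue v x + residue v y.
Proof.
move=> vx vy; rewrite /residue -rmorphD; congr \pi; apply: val_inj.
by rewrite rmorphD /= !insubdK // rpredD.
Qed.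

Lemma residueM x y : x \in valring v -> y \in valring v ->
  residue v (x * y) = residue v x * residue v y.
Proof.
move=> vx vy; rewrite /residue -rmorphM; congr \pi; apply: val_inj.
by rewrite rmorphM /= !insubdK // rpredM.
Qed.

Lemma residue1 : residue v 1 = 1.
Proof.
rewrite /residue -(rmorph1 (\pi_(residue_field v))); congr \pi; apply: val_inj.
by rewrite rmorph1 /= insubdK // rpred1.
Qed.

Lemma residue0 : residue v 0 = 0.
Proof. by apply/eqP; rewrite residue_eq0 ?rpred0 // val0. Qed.

Lemma residue_sum I (r : seq I) (P : pred I) (F : I -> K) :
    (forall i, P i -> F i \in valring v) ->
  residue v (\sum_(i <- r | P i) F i) = \sum_(i <- r | P i) residue v (F i).
Proof.
move=> vF; elim: r => [|i r IH]; first by rewrite !big_nil residue0.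
rewrite !big_cons; case: ifP => // Pi.
by rewrite residueD ?IH ?vF ?rpred_sum.
Qed.

Lemma residue_prod I (r : seq I) (P : pred I) (F : I -> K) :
    (forall i, P i -> F i \in valring v) ->
  residue v (\prod_(i <- r | P i) F i) = \prod_(i <- r | P i) residue v (F i).
Proof.
move=> vF; elim: r => [|i r IH]; first by rewrite !big_nil residue1.
rewrite !big_cons; case: ifP => // Pi.
by rewrite residueM ?IH ?vF ?rpred_prod.
Qed.

Lemma residue_neq0 x : v x = Some 0 -> residue v x != 0.
Proof.
move=> vx; rewrite residue_eq0 ?val0_valring // vx /vlt negbK /=.
exact: lexle_refl.
Qed.

Lemma residueV x : v x = Some 0 -> residue v x^-1 = (residue v x)^-1.
Proof.
move=> vx; have vxV : v x^-1 = Some 0 by rewrite (valV vx) oppr0.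
apply: (mulIf (residue_neq0 vx)); rewrite mulVf ?residue_neq0 //.
rewrite -residueM ?val0_valring // mulVf ?residue1 //.
exact: val_neq0_of_Some vx.
Qed.

Lemma residueXz x c : v x = Some 0 -> residue v (x ^ c) = residue v x ^ c.
Proof.
move=> vx; have vXn d : v (x ^+ d) = Some 0.
  by have := val_exprz d vx; rewrite mul0rz.
have Xn d : residue v (x ^+ d) = residue v x ^+ d.
  elim: d => [|d IH]; first exact: residue1.
  by rewrite !exprS residueM ?IH ?val0_valring.
case: c => d; first exact: Xn.
by rewrite NegzE -!invr_expz (residueV (vXn _)); congr (_^-1); apply: Xn.
Qed.

End Residue.

(** Clears denominators: in each coordinate [C] adds up the absolute values over the finite family,
    so a single shift makes all exponents nonnegative. *)
Lemma mnm_exponent_shift r (I : finType) (e : I -> 'rV[int]_r) :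
  exists (C : 'X_{1..r}) (E : I -> 'X_{1..r}),
    forall i, mnm_exponent (E i) = e i + mnm_exponent C.
Proof.
pose M l := (\sum_i `|e i 0%R l|)%N.
pose E i := [multinom `|(e i 0 l + (M l)%:Z)%R|%N | l < r].
exists [multinom M l | l < r], E => i.
apply/rowP => l; rewrite !mxE !mnmE gez0_abs // /M (bigD1 i) //= PoszD addrA.
by rewrite addr_ge0 // abszE -lerBlDl sub0r -normrN ler_norm.
Qed.

(** * Lower bounds for values and parts of minimal degree *)

Section CenteredValuation.
Variables (n m : nat) (k : fieldType) (v : valuation (psfrac n k) m).
Hypothesis v_cent : centered v.
Variable B : 'I_n -> 'rV[int]_m.
Hypothesis vX : forall i, v (psemb (pseriesX k i)) = Some (B i).
Implicit Types (f g : pseries n k) (A C : 'X_{1..n}) (b : 'rV[int]_m).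

Let deg A := Ldeg B (mnm_exponent A).

Lemma val_psmon y : v (psmon k y) = Some (Ldeg B y).
Proof.
rewrite /psmon /Ldeg; elim/big_rec2: _ => [|i a x _ vx]; first exact: Defs.val1.
by rewrite val_mul vx (val_exprz _ (vX i)).
Qed.

Lemma degD A C : deg (A + C)%MM = deg A + deg C.
Proof. by rewrite /deg mnm_exponentD LdegD. Qed.

Lemma deg_ge0 A : lexle 0 (deg A).
Proof. by have [] := v_cent (psX k A); rewrite -psmon_mnm val_psmon. Qed.

Lemma deg_mono A C : (A <= C)%MM -> lexle (deg A) (deg C).
Proof. by move=> leAC; rewrite -(submK leAC) degD lexle_add0 // deg_ge0. Qed.

(** Induction on [s]: the terms divisible by [X^C] form [X^C * g], of value at least [deg C] because
    [v] is nonnegative on power series; the rest is covered by the tail of [s]. *)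
Lemma val_ge_cover (s : seq 'X_{1..n}) f (c : exval m) :
    (forall A, pcoef f A != 0 -> exists2 C, C \in s & (C <= A)%MM) ->
    {in s, forall C, vle c (Some (deg C))} ->
  vle c (v (psemb f)).
Proof.
elim: s f => [|C s IH] f covf les.
  suff -> : f = 0 by rewrite psemb0 val0; case: c {les}.
  by apply: pseriesP => A; apply/eqP; apply: contrapT => /negP/covf[].
pose g := PSeries (fun A => pcoef f (A + C)%MM).
pose h := PSeries (fun A => if (C <= A)%MM then 0 else pcoef f A).
have -> : f = psX k C * g + h.
  apply: pseriesP => A; rewrite pcoefD pcoefXM /=.
  by case: ifP => [leCA|]; rewrite ?addr0 ?add0r // submK.
rewrite psembD; apply: vle_trans (val_add v _ _); apply: vle_min.
  rewrite psembM -psmon_mnm val_mul val_psmon -/(deg C).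
  apply: vle_trans (les C (mem_head _ _)) _.
  have [] := v_cent g; case: (v _) => [b|] //= b0 _.
  by rewrite addrC lexle_add0.
apply: IH => [A|D Ds]; last by apply: les; rewrite inE Ds orbT.
rewrite /=; case: ifPn; rewrite ?eqxx // => nleCA /covf[D].
by rewrite inE => /predU1P[->|Ds] leDA; [rewrite leDA in nleCA | exists D].
Qed.

(* By Dickson's lemma, f is a finite combination, with coefficients in the
   power series ring, of monomials of its support. *)
Lemma min_deg_supp f : f != 0 -> exists A,
  [/\ pcoef f A != 0,
      forall C, pcoef f C != 0 -> lexle (deg A) (deg C)
    & vle (Some (deg A)) (v (psemb f))].
Proof.
move=> f0; have [s sf covf] := dickson (fun A => pcoef f A != 0).
(* The minimum is taken over the finite list [s], nonempty since [f] is nonzero; monotonicity of the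
   degree extends it to the whole support. *)
have [A As minA] : exists2 A, A \in s & {in s, forall C, lexle (deg A) (deg C)}.
  have [A0 /covf[C0 C0s _] _] := ps_min_supp f0.
  elim: s C0 C0s {sf covf} => // C s IH _ _.
  case: s IH => [_|D s IH].
    by exists C => [|D]; rewrite inE ?eqxx // => /eqP->; apply: lexle_refl.
  have [A As minA] := IH D (mem_head _ _).
  have [leAC|leCA] := orP (lexle_total (deg A) (deg C)).
    by exists A => [|E]; rewrite inE ?As ?orbT // => /predU1P[->|/minA].
  exists C => [|E]; rewrite inE ?eqxx // => /predU1P[->|/minA].
    exact: lexle_refl.
  exact: lexle_trans.
exists A; split; first exact: sf.
  move=> C /covf[D Ds leDC].
  exact: lexle_trans (minA D Ds) (deg_mono leDC).
by apply: (val_ge_cover covf) => C /minA.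
Qed.

Definition ps_off b f := PSeries (fun A => if deg A == b then 0 else pcoef f A).

(** The value is bounded below by the least degree in the support of [ps_off b f], which is at least
    [b] and differs from [b]. *)
Lemma val_ps_off b f : (forall A, pcoef f A != 0 -> lexle b (deg A)) ->
  vlt (Some b) (v (psemb (ps_off b f))).
Proof.
move=> minb; have [->|f0] := eqVneq (ps_off b f) 0; first by rewrite psemb0 val0.
have [A [fA _ leA]] := min_deg_supp f0.
apply: vlt_le_trans leA; move: fA => /=.
case: (deg A =P b) => [_|neq /minb leb]; first by rewrite eqxx.
by apply/negP => /= leA; case: neq; apply: lexle_anti.
Qed.

Section FiniteDegree.
Hypothesis B_ge0 : forall i j, 0 <= B i 0 j.
Hypothesis B_neq0 : forall i, B i != 0.

(** The entries of each [B i] sum to at least 1, so the entries of [deg A] sum to at least the total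
    degree of [A]. Hence each L-degree has only finitely many monomials. *)
Lemma mdeg_le_deg A : (mdeg A <= `|(\sum_j deg A 0 j)%R|)%N.
Proof.
have B1 i : 1 <= \sum_j B i 0 j.
  rewrite -gtz0_ge1 lt_def sumr_ge0 // andbT.
  apply: contra (B_neq0 i) => /eqP/psumr_eq0P B0.
  by apply/eqP/rowP => j; rewrite B0 // mxE.
have -> : \sum_j deg A 0 j = \sum_i (\sum_j B i 0 j) * (A i)%:Z.
  under [RHS]eq_bigr => i _ do rewrite mulr_suml.
  rewrite exchange_big; apply: eq_bigr => j _.
  rewrite /deg Ldeg_mx mxE; apply: eq_bigr => i _.
  by rewrite !mxE mulrC.
rewrite -lez_nat mdegE (big_morph _ PoszD (erefl 0%:Z)) gez0_abs; last first.
  by apply: sumr_ge0 => i _; apply: mulr_ge0 => //; apply: le_trans (B1 i).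
by apply: ler_sum => i _; apply: ler_peMl.
Qed.

Lemma psemb_split b f : exists N,
  (forall A, deg A = b -> (mdeg A < N)%N) /\
  psemb f = \sum_(A : 'X_{1..n < N} | deg A == b)
              psfracC n (pcoef f A) * psmon k (mnm_exponent A)
            + psemb (ps_off b f).
Proof.
(* The successor turns the bound of [mdeg_le_deg] into the strict one required by the index type. *)
pose N := `|(\sum_j b 0 j)%R|%N.+1.
have ltN A : deg A = b -> (mdeg A < N)%N.
  by rewrite /N => <-; rewrite ltnS mdeg_le_deg.
exists N; split=> //.
under eq_bigr => A _ do rewrite psmon_mnm -psembM.
rewrite -psemb_sum -psembD; congr psemb; apply: pseriesP => A.
rewrite pcoefD pcoef_sum; under eq_bigr => C _ do rewrite pcoefCM.
rewrite /=; case: eqP => [degA|ndegA].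
  rewrite addr0 (bigD1 (BMultinom (ltN A degA))) /=; last by rewrite -degA.
  rewrite eqxx mulr1 big1 ?addr0 // => C /andP[_ neq].
  case: eqP => [eqA|]; last by rewrite mulr0.
  by case/eqP: neq; apply: val_inj; rewrite /= -eqA.
rewrite big1 ?add0r // => C /eqP degC.
by case: eqP => [eqA|_]; [rewrite eqA degC in ndegA | rewrite mulr0].
Qed.

End FiniteDegree.
End CenteredValuation.

(** * Evaluation of polynomials and Laurent sums *)

Section EvaluationOfPolynomials.
Variables (k F : fieldType) (iota : k -> F) (r : nat) (t : 'I_r -> F).
Hypotheses (iotaB : {morph iota : x y / x - y}).
Hypotheses (iotaM : GRing.monoid_morphism iota).

(** [iota] stays a plain function because it will be instantiated with
    [fun c => residue v (psfracC n c)]; its morphism structure is packed locally for the lemmas on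
    [mmap]. *)
Let iotaRM : {rmorphism k -> F} := HB.pack_for {rmorphism k -> F} iota
  (GRing.isZmodMorphism.Build k F _ iotaB)
  (GRing.isMonoidMorphism.Build k F _ iotaM).

Lemma mmap_bounded p N : (msize p <= N)%N ->
  mmap iota t p =
  \sum_(C : 'X_{1..r < N}) iota p@_C * \prod_j t j ^ mnm_exponent C 0 j.
Proof.
move=> leN; rewrite -[iota]/(iotaRM : k -> F) (mmapE N) //.
by apply: eq_bigr => C _; congr (_ * _); apply: eq_bigr => j _; rewrite mxE.
Qed.

Lemma mmap_sum_mpolyX (I : finType) (P : pred I) (c : I -> k)
    (E : I -> 'X_{1..r}) :
  mmap iota t (\sum_(i | P i) c i *: 'X_[E i]) =
  \sum_(i | P i) iota (c i) * \prod_j t j ^ mnm_exponent (E i) 0 j.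
Proof.
rewrite -[iota]/(iotaRM : k -> F) raddf_sum /=; apply: eq_bigr => i _.
rewrite (mmapZ t iotaRM) (mmapX t iotaRM); congr (_ * _); apply: eq_bigr => j _.
by rewrite mxE.
Qed.

(** A Laurent sum evaluated at nonzero points is, up to the nonzero factor coming from [C], the
    value of a genuine polynomial, to which algebraic independence applies. *)
Lemma mmap_sum_shift (I : finType) (P : pred I) (c : I -> k)
    (e : I -> 'rV[int]_r) (C : 'X_{1..r}) (E : I -> 'X_{1..r}) :
    (forall j, t j != 0) ->
    (forall i, mnm_exponent (E i) = e i + mnm_exponent C) ->
  mmap iota t (\sum_(i | P i) c i *: 'X_[E i]) =
  (\sum_(i | P i) iota (c i) * \prod_j t j ^ e i 0 j)
    * \prod_j t j ^ mnm_exponent C 0 j.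
Proof.
move=> t0 EC; rewrite mmap_sum_mpolyX mulr_suml; apply: eq_bigr => i _.
rewrite EC -mulrA; congr (_ * _); rewrite -big_split; apply: eq_bigr => j _.
by rewrite mxE expfzDr.
Qed.

End EvaluationOfPolynomials.

(** * Homogeneous Laurent sums and the L-order *)

Section HomogeneousSums.
Variables (n m : nat) (k : fieldType) (v : valuation (psfrac n k) m).
Hypothesis v_triv : trivial_on (@psfracC n k) v.
Hypothesis v_cent : centered v.
Variable B : 'I_n -> 'rV[int]_m.
Hypothesis vX : forall i, v (psemb (pseriesX k i)) = Some (B i).
Implicit Types (f g : pseries n k) (b : 'rV[int]_m).

Lemma psfracC0 : psfracC n (0 : k) = 0.
Proof.
rewrite /psfracC; have -> : pseriesC n (0 : k) = 0.
  by apply: pseriesP => A /=; case: ifP.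
exact: psemb0.
Qed.

Lemma psfracC_valring c : psfracC n c \in valring v.
Proof.
have [->|c0] := eqVneq c 0; first by rewrite psfracC0 rpred0.
exact/val0_valring/v_triv.
Qed.

Lemma residueCB : {morph (fun c => residue v (psfracC n c)) : x y / x - y}.
Proof.
move=> x y /=; apply/eqP; rewrite eq_sym subr_eq; apply/eqP.
rewrite -residueD ?psfracC_valring // -psembD; congr (residue v (psemb _)).
by apply: pseriesP => A /=; case: ifP; rewrite ?addr0 ?subrK.
Qed.

Lemma residueCM : GRing.monoid_morphism (fun c => residue v (psfracC n c)).
Proof.
split=> [|x y]; first by rewrite -(residue1 v) -(rmorph1 (@psemb n k)).
rewrite -residueM ?psfracC_valring // -psembM; congr (residue v (psemb _)).
by apply: pseriesP => A; rewrite pcoefCM /=; case: ifP; rewrite ?mulr0.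
Qed.

(* Linear independence over k, modulo higher values, of the Laurent monomials
   of a given degree. *)
Definition homog_values := forall (I : finType) (P : pred I) (c : I -> k)
    (y : I -> 'rV[int]_n) b i0,
  {in P &, injective y} -> (forall i, P i -> Ldeg B (y i) = b) ->
  P i0 -> c i0 != 0 ->
  v (\sum_(i | P i) psfracC n (c i) * psmon k (y i)) = Some b.

(** Multiplication by a monomial [X^C] turns the sum into a nonzero power series [f], all of whose
    monomials have degree [b + deg C]; this is its L-order, hence its value. *)
Lemma monomial_homog : monomial_valuation B v -> homog_values.
Proof.
move=> v_mono I P c y b i0 injy degy Pi0 ci0.
have [C [E EC]] := mnm_exponent_shift y.
set S := (S in v S); pose f := \sum_(i | P i) pseriesC n (c i) * psX k (E i).
have fE : psemb f = S * psmon k (mnm_exponent C).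
  rewrite psemb_sum mulr_suml; apply: eq_bigr => i Pi.
  by rewrite psembM -psmon_mnm EC psmonD mulrA.
have coef_f A : pcoef f A = \sum_(i | P i) c i * (A == E i)%:R.
  by rewrite pcoef_sum; apply: eq_bigr => i _; rewrite pcoefCM.
have injE : {in P &, injective E}.
  move=> i j Pi Pj eqE; apply: injy => //.
  by apply: (addIr (mnm_exponent C)); rewrite -!EC eqE.
have f0 : f != 0.
  apply/eqP => f0; case/eqP: ci0; transitivity (pcoef f (E i0)).
    rewrite coef_f (bigD1 i0) //= eqxx mulr1 big1 ?addr0 // => i /andP[Pi nei].
    by case: eqP => [/injE ei|]; rewrite ?mulr0 // ei ?eqxx in nei *.
  by rewrite f0.
have := v_mono f; have := val_mul v S (psmon k (mnm_exponent C)).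
rewrite -fE (val_psmon vX); have [d vd] : exists d, v (psemb f) = Some d.
  by apply: val_neq0; rewrite psemb_eq0.
rewrite vd => vS [[A fA dA] _].
(* The monomial attaining the L-order must be one of the shifted exponents. *)
have [i Pi EA] : exists2 i, P i & A = E i.
  apply: contrapT => nE; case/eqP: fA; rewrite coef_f big1 // => i Pi.
  by case: eqP => [eA|]; rewrite ?mulr0 //; case: nE; exists i.
move: vS; rewrite dA EA EC LdegD degy //; case: (v S) => [a|] //= [].
by move/addIr => ->.
Qed.

(** With [b] the least degree in the support of [f], the part of degree [b] has value exactly [b] by
    [homog_values], and the remainder has larger value. *)
Lemma homog_monomial : (forall i j, 0 <= B i 0 j) -> (forall i, B i != 0) ->
  homog_values -> monomial_valuation B v.
Proof.
move=> B_ge0 B_neq0 vhom f.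
have [->|f0] := eqVneq f 0; first by rewrite psemb0 val0.
have [A [fA minA _]] := min_deg_supp v_cent vX f0.
set b := Ldeg B _ in minA.
have [N [ltN ->]] := psemb_split B_ge0 B_neq0 b f.
have vF := vhom _ (fun C : 'X_{1..n < N} => Ldeg B (mnm_exponent C) == b)
  (fun C => pcoef f C) (fun C => mnm_exponent C) b (BMultinom (ltN A (erefl _))).
rewrite val_addl vF //=; try by [split; [exists A|] | move=> C /eqP
  | move=> C D _ _ /mnm_exponent_inj/val_inj].
exact: val_ps_off.
Qed.

(** * The lattice of relations and the residue field *)

Section KernelBasis.
Variables (r : nat) (A : 'I_r -> 'rV[int]_n).
Hypothesis A_basis : Zbasis A (fun y => Ldeg B y = 0).

Let t j := residue v (psmon k (A j)).
Let comb (e : 'rV[int]_r) := \sum_j A j *~ e 0 j.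

Lemma Ldeg_comb e : Ldeg B (comb e) = 0.
Proof. by apply/A_basis.1; exists (e 0). Qed.

Lemma comb_inj : injective comb.
Proof.
move=> e e' eq_e; apply/rowP => j; apply/eqP; rewrite -subr_eq0; apply/eqP.
apply: (A_basis.2 (fun j => e 0 j - e' 0 j)).
transitivity (comb e - comb e'); last by rewrite eq_e subrr.
by rewrite -sumrB; apply: eq_bigr => i _; rewrite mulrzBr.
Qed.

Lemma val_psmon_basis j : v (psmon k (A j)) = Some 0.
Proof.
rewrite (val_psmon vX); congr Some; apply/A_basis.1.
exists (fun i => (i == j)%:Z); rewrite (bigD1 j) //= eqxx big1 ?addr0 //.
by move=> i /negPf ->.
Qed.

Lemma residue_basis_neq0 j : t j != 0.
Proof. exact/residue_neq0/val_psmon_basis. Qed.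

Lemma residue_comb e : residue v (psmon k (comb e)) = \prod_j t j ^ e 0 j.
Proof.
rewrite psmon_sum residue_prod => [|j _].
  by apply: eq_bigr => j _; rewrite psmonMz residueXz ?val_psmon_basis.
by rewrite psmonMz val0_valring // (val_exprz _ (val_psmon_basis j)) mul0rz.
Qed.

Lemma comb_valring e : psmon k (comb e) \in valring v.
Proof. by rewrite val0_valring // (val_psmon vX) Ldeg_comb. Qed.

(** Passage from [K] to the residue field: a Laurent polynomial in the basis monomials reduces to
    the same Laurent polynomial evaluated at [t]. *)
Lemma residue_combination (I : finType) (P : pred I) (c : I -> k)
    (e : I -> 'rV[int]_r) :
  residue v (\sum_(i | P i) psfracC n (c i) * psmon k (comb (e i))) =
  \sum_(i | P i) residue v (psfracC n (c i)) * \prod_j t j ^ e i 0 j.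
Proof.
rewrite residue_sum => [|i _].
  apply: eq_bigr => i _.
  by rewrite residueM ?psfracC_valring ?comb_valring // residue_comb.
by rewrite rpredM ?psfracC_valring ?comb_valring.
Qed.

(** A nonzero [p] lifts to a sum of distinct Laurent monomials of degree 0 with a nonzero
    coefficient. Its value is 0, so its residue, which is [p] evaluated at [t], is nonzero. *)
Lemma homog_alg_independent :
  homog_values -> alg_independent (fun c => residue v (psfracC n c)) t.
Proof.
move=> vhom p mp0; apply/eqP; apply: contrapT => /negP p0.
have [A0 pA0] : exists A0, p@_A0 != 0.
  apply: contrapT => np; case/eqP: p0; apply/mpolyP => C; rewrite mcoeff0.
  by apply: contrapT => /eqP pC; case: np; exists C.
have ltA0 : (mdeg A0 < msize p)%N by rewrite msize_mdeg_lt // mcoeff_msupp.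
have : v (\sum_(C : 'X_{1..r < msize p})
    psfracC n p@_C * psmon k (comb (mnm_exponent C))) = Some 0.
  apply: (vhom _ predT (fun C : 'X_{1..r < msize p} => p@_C)
    (fun C => comb (mnm_exponent C)) 0 (BMultinom ltA0)) => //.
    by move=> C D _ _ /comb_inj/mnm_exponent_inj/val_inj.
  by move=> C _; apply: Ldeg_comb.
move/residue_neq0; rewrite residue_combination => /eqP; apply.
by rewrite -[RHS]mp0 (@mmap_bounded k (residue_field v) _ r t
  residueCB residueCM p _ (leqnn _)).
Qed.

(** Dividing by the monomial of index [i0] leaves a Laurent polynomial [S] in the basis monomials.
    Independence makes its residue nonzero, so [S] has value 0. *)
Lemma alg_independent_homog :
  alg_independent (fun c => residue v (psfracC n c)) t -> homog_values.
Proof.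
move=> indep I P c y b i0 injy degy Pi0 ci0.
(* [choice] needs a witness at every index; outside [P] it is 0. *)
have /choice[e eE] i : exists e, P i -> y i = y i0 + comb e.
  case Pi: (P i); last by exists 0.
  have /A_basis.1[e eE] : Ldeg B (y i - y i0) = 0 by rewrite LdegB !degy // subrr.
  exists (\row_j e j) => _; apply/eqP; rewrite addrC -subr_eq eE; apply/eqP.
  by apply: eq_bigr => j _; rewrite mxE.
set S := \sum_(i | P i) psfracC n (c i) * psmon k (comb (e i)).
have -> : \sum_(i | P i) psfracC n (c i) * psmon k (y i) = psmon k (y i0) * S.
  rewrite mulr_sumr; apply: eq_bigr => i Pi.
  by rewrite eE // psmonD mulrCA.
have vS : S \in valring v.
  by apply: rpred_sum => i _; rewrite rpredM ?psfracC_valring ?comb_valring.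
rewrite val_mul (val_psmon vX) degy //.
suff -> : v S = Some 0 by rewrite /= addr0.
suff : residue v S != 0.
  rewrite residue_eq0 // /vlt negbK; move: vS; rewrite inE.
  by case: (v S) => [a|] //= a0 a0'; rewrite (lexle_anti a0 a0').
have [C [E EC]] := mnm_exponent_shift e.
pose p : {mpoly k[r]} := \sum_(i | P i) c i *: 'X_[E i].
have p0 : p != 0.
  (* Injectivity of [y] on [P] passes to [E], so no other term cancels [c i0]. *)
  apply/eqP => p0; case/eqP: ci0; transitivity (p@_(E i0)).
    rewrite /p raddf_sum (bigD1 i0) //= mcoeffZ mcoeffX eqxx mulr1.
    rewrite big1 ?addr0 // => i /andP[Pi nei]; rewrite mcoeffZ mcoeffX.
    case: eqP => [eqE|]; last by rewrite mulr0.
    case/eqP: nei; apply: injy => //; rewrite eE // [RHS]eE //.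
    congr (_ + comb _).
    by apply: (addIr (mnm_exponent C)); rewrite -!EC eqE.
  by rewrite p0 mcoeff0.
apply: contra_neq p0 => S0; apply: indep.
rewrite (@mmap_sum_shift k (residue_field v) _ r t residueCB residueCM
  _ _ _ _ _ _ residue_basis_neq0 EC).
by rewrite -residue_combination -/S S0 mul0r.
Qed.

(** An element of value 0 is a quotient of two series of equal value [b]. Both are divided by one
    Laurent monomial of degree [b], which exists since the [B i] generate; the residues of the
    results lie in the generated field. *)
Lemma residue_generated :
    (forall i j, 0 <= B i 0 j) -> (forall i, B i != 0) ->
    (forall b, exists a, b = Ldeg B a) -> monomial_valuation B v ->
  generated_over (fun c => residue v (psfracC n c)) t.
Proof.
move=> B_ge0 B_neq0 B_gen v_mono P divP PC Pt z.
pose PP := GRing.isDivringClosed.Build _ P divP.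
pose Pd : divringClosed (residue_field v) :=
  HB.pack_for (divringClosed (residue_field v)) P PP.
have PdE x : (x \in Pd) = (x \in P) by [].
rewrite -PdE.
(* After normalisation, only the part of degree [b] contributes to the residue, and it becomes a
   Laurent polynomial in the basis monomials. *)
have init f b a : v (psemb f) = Some b -> b = Ldeg B a ->
    residue v (psmon k (- a) * psemb f) \in Pd.
  move=> vf ba; have := v_mono f; rewrite vf => -[_ minb].
  have off_gt0 : vlt (Some 0) (v (psmon k (- a) * psemb (ps_off B b f))).
    rewrite val_mul (val_psmon vX) LdegN -ba vlt_addN.
    exact: val_ps_off.
  have [N [_ ->]] := psemb_split B_ge0 B_neq0 b f.
  have combE (A' : 'X_{1..n < N}) : Ldeg B (mnm_exponent A') = b ->
      exists e, psmon k (- a) * psmon k (mnm_exponent A') = psmon k (comb e).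
    rewrite -psmonD => dA.
    have /A_basis.1[e ->] : Ldeg B (- a + mnm_exponent A') = 0.
      by rewrite LdegD LdegN dA ba addNr.
    by exists (\row_j e j); congr psmon; apply: eq_bigr => j _; rewrite mxE.
  rewrite mulrDr mulr_sumr residueD; last 2 first.
  - apply: rpred_sum => A' /eqP/combE[e eE].
    by rewrite mulrCA eE rpredM ?psfracC_valring ?comb_valring.
  - exact: vlt_vle.
  have -> : residue v (psmon k (- a) * psemb (ps_off B b f)) = 0.
    by apply/eqP; rewrite residue_eq0 //; apply: vlt_vle.
  rewrite addr0 residue_sum => [|A' /eqP/combE[e eE]]; last first.
    by rewrite mulrCA eE rpredM ?psfracC_valring ?comb_valring.
  apply: rpred_sum => A' /eqP/combE[e eE].
  rewrite mulrCA eE residueM ?psfracC_valring ?comb_valring //.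
  rewrite rpredM ?PdE ?PC // -PdE.
  rewrite residue_comb; apply: rpred_prod => j _.
  by case: (e 0 j) => d; rewrite ?NegzE -?invr_expz ?rpredV rpredX // PdE Pt.
rewrite -(residue_repr z); move: (valP (repr z)); set y := val _ => vy.
have [vy0|nvy] := boolP (vlt (Some 0) (v y)).
  by move: vy0; rewrite -residue_eq0 // => /eqP ->; apply: rpred0.
have {nvy} vy0 : v y = Some 0.
  move: vy nvy; rewrite inE /vlt negbK; case: (v y) => [d|] //= d0 d0'.
  by rewrite (lexle_anti d0 d0').
have [f [g g0 yE]] := psfracE y.
have [b vg] : exists b, v (psemb g) = Some b.
  by apply: val_neq0; rewrite psemb_eq0.
have vf : v (psemb f) = Some b.
  have -> : psemb f = y * psemb g by rewrite yE divfK // psemb_eq0.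
  by rewrite val_mul vy0 vg /= add0r.
have [a ba] := B_gen b.
have vmon h : v (psemb h) = Some b -> v (psmon k (- a) * psemb h) = Some 0.
  by move=> vh; rewrite val_mul (val_psmon vX) vh LdegN ba /= addNr.
have -> : y = (psmon k (- a) * psemb f) * (psmon k (- a) * psemb g)^-1.
  by rewrite yE -mulf_div divff ?mul1r // psmon_neq0.
rewrite residueM ?val0_valring ?vmon //; last first.
  by rewrite (valV (vmon _ vg)) oppr0.
by rewrite residueV ?vmon // rpred_div ?(init _ _ _ _ ba).
Qed.

End KernelBasis.
End HomogeneousSums.

(** * A basis of the relations between the [B i] *)

(** In the Smith form [L *m D *m R] all [m] diagonal entries are nonzero, so [y] is a relation
    exactly when the first [m] entries of [y *m L] vanish. The last [r] rows of the inverse of [L]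
    are therefore a basis. *)
Lemma kernel_Zbasis n m r (B : 'I_n -> 'rV[int]_m) : n = (m + r)%N ->
    (forall b, exists a, b = Ldeg B a) ->
  exists A : 'I_r -> 'rV[int]_n, Zbasis A (fun y => Ldeg B y = 0).
Proof.
move=> n_mr; case: _ / (esym n_mr) B => B B_gen {n n_mr}.
have [L Lunit [R Runit [d _ BLR]]] := int_Smith_normal_form (\matrix_i B i).
move: BLR; set D := (X in _ *m X *m _) => BLR.
have DE (w : 'rV_(m + r)) j : (w *m D) 0 j = w 0 (lshift r j) * d`_j.
  rewrite mxE (bigD1 (lshift r j)) //= big1 ?addr0 => [|i neq].
    by rewrite mxE /= eqxx.
  rewrite mxE; case: eqP => [eqij|]; rewrite ?mulr0 //.
  by case/eqP: neq; apply: val_inj.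
(* A zero diagonal entry would keep row [j] of [R] out of the image, against [B_gen]. *)
have d_neq0 (j : 'I_m) : d`_j != 0.
  apply/eqP => d0; have [y] := B_gen (delta_mx 0 j *m R).
  rewrite Ldeg_mx BLR !mulmxA => /(can_inj (mulmxK Runit))/rowP/(_ j)/eqP.
  by rewrite DE d0 mulr0 mxE !eqxx oner_eq0.
have Ldeg0 y : Ldeg B y = 0 <-> exists c, y = row_mx 0 c *m invmx L.
  split=> [|[c ->]].
    rewrite Ldeg_mx BLR !mulmxA => /(canRL (mulmxK Runit)); rewrite mul0mx => yLD.
    exists (rsubmx (y *m L)); apply: (canRL (mulmxK Lunit)).
    rewrite -[LHS]hsubmxK; congr row_mx; apply/rowP => j.
    rewrite mxE [RHS]mxE; have := DE (y *m L) j; rewrite yLD [LHS]mxE.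
    by move/esym/eqP; rewrite mulf_eq0 (negPf (d_neq0 j)) orbF => /eqP.
  rewrite Ldeg_mx BLR !mulmxA mulmxKV //.
  suff -> : row_mx 0 c *m D = 0 by rewrite mul0mx.
  by apply/rowP => j; rewrite DE row_mxEl !mxE mul0r.
exists (fun j => row (rshift m j) (invmx L)).
have combE (c : 'I_r -> int) : \sum_j row (rshift m j) (invmx L) *~ c j =
    row_mx 0 (\row_j c j) *m invmx L.
  rewrite mulmx_sum_row big_split_ord /= [X in X + _]big1 ?add0r => [|j _].
    by apply: eq_bigr => j _; rewrite row_mxEr mxE -scaler_int intz.
  by rewrite row_mxEl mxE scale0r.
split=> [y|c].
  rewrite Ldeg0; split=> [[c ->]|[c ->]].
    exists (c 0); rewrite combE; congr (row_mx _ _ *m _).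
    by apply/rowP => j; rewrite mxE.
  by exists (\row_j c j); rewrite combE.
rewrite combE => /(canRL (mulmxKV Lunit)).
rewrite mul0mx -row_mx0 => /eq_row_mx[_ /rowP c0] j.
by have := c0 j; rewrite !mxE.
Qed.

Theorem theorem6 (k : closedFieldType) (n m : nat) (hmn : (0 < m <= n)%N)
    (v : valuation (psfrac n k) m)
    (v_triv : trivial_on (@psfracC n k) v)
    (v_rank : discrete_of_rank v m)
    (v_cent : centered v)
    (B : 'I_n -> 'rV[int]_m)
    (vX : forall i, v (psemb (pseriesX k i)) = Some (B i))
    (B_ge0 : forall i j, 0 <= B i 0 j)
    (B_neq0 : forall i, B i != 0)
    (B_gen : forall b, exists a, b = Ldeg B a) :
  monomial_valuation B v
  <->
  exists A : 'I_(n - m) -> 'rV[int]_n,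
    [/\ Zbasis A (fun y => Ldeg B y = 0),
        generated_over (fun c => residue v (psfracC n c))
                       (fun j => residue v (psmon k (A j)))
      & alg_independent (fun c => residue v (psfracC n c))
                        (fun j => residue v (psmon k (A j)))].
Proof.
split=> [v_mono | [A [A_basis _ A_indep]]].
  have n_mr : n = (m + (n - m))%N by rewrite subnKC //; case/andP: hmn.
  have [A A_basis] := kernel_Zbasis n_mr B_gen; exists A; split=> //.
    exact: residue_generated.
  apply: homog_alg_independent => //; exact: monomial_homog.
apply: homog_monomial => //; exact: alg_independent_homog A_indep.
Qed.
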